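(* Let $A$ be a pre-sheaf on a topological space $X$ with the following gluing property: if $\{U_j\}$ is a family of open subsets of $X$ with $\bigcup_jU_j=U$ and $s_j\in A(U_j)$ are elements with $s_j|_{U_j\cap U_k}=s_k|_{U_j\cap U_k}$ for all $j,k$, then there exists $s\in A(U)$ with $s|_{U_j}=s_j$ for each $j$; and let $\mathcal S$ be the sheaf generated by $A$, where $\mathcal S$ and $A$ are twisted over $\{i_0,\dots,i_{2^r-1}\}$ with $1\le r\le3$. Then for each paracompactifying family $\phi$ of supports in $X$ there is an exact sequence $$e\to A_0(X)\to A_\phi(X)\stackrel{\theta}{\longrightarrow}\Gamma_\phi(\mathcal S)\to e,$$ where $\theta:A(X)\to\mathcal S(X)$ is the natural mapping of the pre-sheaf into the sheaf generated by it.
   Context: $\mathcal A_1=\mathbf C,\mathcal A_2=\mathbf H,\mathcal A_3=\mathbf O$ with standard generators $i_0=1,\dots,i_{2^r-1}$. A group here need not be associative. A group $G$ is twisted over $\{i_0,\dots,i_{2^r-1}\}$ if (A1) it is alternative: $g(gf)=(gg)f$, $(fg)g=f(gg)$, $g^{-1}(gf)=f$, $(fg)g^{-1}=f$ for all $f,g$; it has a conjugation, a continuous automorphism with (C1) $conj(gf)=conj(f)conj(g)$ and (C2) $conj(e)=e$; and (A2) $G$ is the multiplicative group of a ring $\hat G=\hat G_0i_0\oplus\dots\oplus\hat G_{2^r-1}i_{2^r-1}$ with pairwise isomorphic commutative associative rings $\hat G_j$ and $(y_li_l)(y_si_s)=(y_ly_s)(i_li_s)$ for $y_l\in\hat G_l$.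 A (pre-)sheaf is twisted if its groups over open sets are twisted (compatibly with restrictions). A family of supports is a family $\phi$ of closed subsets of $X$ such that (SP1) a closed subset of a member of $\phi$ is in $\phi$; (SP2) finite unions of members of $\phi$ are in $\phi$. It is paracompactifying if also (SP3) each member is paracompact; (SP4) each member has a closed neighborhood belonging to $\phi$. For a section $s\in\mathcal S(X)$, $|s|:=\{x\in X:s(x)\ne e\}$; for $s\in A(X)$, $|s|:=|\theta(s)|$. $\Gamma_\phi(\mathcal S):=\{s\in\mathcal S(X):|s|\in\phi\}$, $A_\phi(X):=\{s\in A(X):|s|\in\phi\}$, and $A_0(X)$ is the subgroup of elements $s\in A(X)$ with empty support, i.e. with $\theta(s)=e$.
   Formalization: The pre-sheaf is assumed to satisfy A(∅)={e}, without which the claim fails (A(U)=C^* for all U, identity restrictions, on the two-point discrete space: θ is the diagonal, not onto); paracompact is taken to include Hausdorff. *)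

(* Defs.v *)
From HB Require Import structures.
From mathcomp Require Import all_boot all_order all_algebra.
From mathcomp Require Import all_classical.
From mathcomp Require Import topology.

Set Implicit Arguments.
Unset Strict Implicit.
Unset Printing Implicit Defensive.

Import GRing.Theory.

Local Open Scope classical_set_scope.
Local Open Scope group_scope.

(** * Non-associative groups and rings *)

(* Unital, with two-sided inverses, but not necessarily associative. *)
HB.mixin Record UMagma_isNAGroup G of UMagma G := {
  na_inv : G -> G;
  mulNAVg : forall x : G, na_inv x * x = 1;
  mulNAgV : forall x : G, x * na_inv x = 1
}.

#[short(type="naGroupType")]
HB.structure Definition NAGroup := {G of UMagma_isNAGroup G & UMagma G}.

Local Notation "x ^-1" := (na_inv x) : group_scope.

Bind Scope group_scope with NAGroup.sort.

(* Preservation of [1] and of inverses follows from the first clause as soon as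
   the groups are alternative. *)
Definition na_morphism (G H : naGroupType) (f : G -> H) : Prop :=
  [/\ {morph f : x y / x * y}, f 1 = 1 & {morph f : x / x^-1}].

Definition na_subgroup (G : naGroupType) (H : set G) : Prop :=
  [/\ H 1, forall x y, H x -> H y -> H (x * y) & forall x, H x -> H x^-1].

(* A unital ring, possibly zero, whose multiplication [*%g] need be neither
   associative nor commutative. *)
HB.mixin Record Zmodule_UMagma_isNARing R of GRing.Zmodule R & UMagma R := {
  mulNADl : forall x y z : R, (x + y)%R * z = ((x * z)%g + (y * z)%g)%R;
  mulNADr : forall x y z : R, x * (y + z)%R = ((x * y)%g + (x * z)%g)%R
}.

#[short(type="naRingType")]
HB.structure Definition NARing :=
  {R of Zmodule_UMagma_isNARing R & GRing.Zmodule R & UMagma R}.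

Definition na_units (R : naRingType) : set R :=
  [set x | exists y, x * y = 1 /\ y * x = 1].
Arguments na_units : clear implicits.

(** * Generators of the Cayley-Dickson algebras *)

(* The Z-span of the standard generators of A_r (C, H, O for r = 1, 2, 3); it
   carries the whole multiplication table of these generators. *)
Fixpoint cd (r : nat) : zmodType :=
  if r is r'.+1 then (cd r' * cd r')%type else int.

Fixpoint cd_conj (r : nat) : cd r -> cd r :=
  if r is r'.+1 then fun x => (cd_conj x.1, - x.2)%R else id.

(* Writing x = a + b l and y = c + d l, the doubling formula is
   x y = (a c - d^* b) + (d a + b c^* ) l. *)
Fixpoint cd_mul (r : nat) : cd r -> cd r -> cd r :=
  if r is r'.+1 then fun x y =>
    (cd_mul x.1 y.1 - cd_mul (cd_conj y.2) x.2,
     cd_mul y.2 x.1 + cd_mul x.2 (cd_conj y.1))%R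
  else fun x y => (x * y)%R.

(* i_0 = 1 and i_{2^r + k} = i_k l for k < 2^r. *)
Fixpoint cd_gen (r : nat) : nat -> cd r :=
  if r is r'.+1 then fun j =>
    if (j < 2 ^ r')%N then (cd_gen r' j, 0%R)
    else (0%R, cd_gen r' (j - 2 ^ r')%N)
  else fun=> 1%R.

(** * Twisted groups *)

Definition alternative (G : naGroupType) : Prop :=
  forall g f : G,
    [/\ g * (g * f) = (g * g) * f, (f * g) * g = f * (g * g),
        g^-1 * (g * f) = f & (f * g) * g^-1 = f].

Definition topology_on (T : Type) := Topological.axioms_ T.
Definition with_topology (T : Type) (tau : topology_on T) : topologicalType :=
  Topological.Pack tau.
Definition continuous_for (T U : Type) (tau : topology_on T)
    (sigma : topology_on U) (f : T -> U) : Prop :=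
  continuous (f : with_topology tau -> with_topology sigma).

(* [tw_in j y] is the element y i_j of the ring; the coherent isomorphisms
   [tw_iso] give a meaning to the product y_l y_s of elements of different
   components. Since i_l i_s = i_m * e with e = 1 or -1 for a single m, [tw_mul]
   is the rule (y_l i_l) (y_s i_s) = (y_l y_s) (i_l i_s). *)
Record twisted_group (r : nat) (G : naGroupType) := TwistedGroup {
  tw_alternative : alternative G;
  tw_top : topology_on G;
  tw_mul_continuous : continuous
    (fun p : with_topology tw_top * with_topology tw_top =>
       @monoid.mul G p.1 p.2 : with_topology tw_top);
  tw_inv_continuous : continuous_for tw_top tw_top (@na_inv G);
  tw_conj : G -> G;
  tw_conj_bij : bijective tw_conj;
  tw_conj_continuous : continuous_for tw_top tw_top tw_conj;
  tw_conjM : forall g f, tw_conj (g * f) = tw_conj f * tw_conj g;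
  tw_conj1 : tw_conj 1 = 1;
  tw_ring : naRingType;
  tw_comp : 'I_(2 ^ r) -> comPzRingType;
  tw_iso : forall j k, {rmorphism tw_comp j -> tw_comp k};
  tw_iso_id : forall j y, tw_iso j j y = y;
  tw_iso_comp : forall j k l y, tw_iso k l (tw_iso j k y) = tw_iso j l y;
  tw_in : forall j, {additive tw_comp j -> tw_ring};
  tw_direct_sum : forall h : tw_ring,
    exists! y : (forall j, tw_comp j), h = (\sum_j tw_in j (y j))%R;
  tw_mul : forall (l s m : 'I_(2 ^ r)) (e : int) (y : tw_comp l) (z : tw_comp s),
    cd_mul (cd_gen r l) (cd_gen r s) = (cd_gen r m *~ e)%R ->
    tw_in l y * tw_in s z = (tw_in m (tw_iso l m y * tw_iso s m z) *~ e)%R;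
  tw_unit : G -> tw_ring;
  tw_unit_inj : injective tw_unit;
  tw_unit_range : range tw_unit = na_units tw_ring;
  tw_unitM : {morph tw_unit : g f / g * f};
  tw_unit1 : tw_unit 1 = 1
}.

Definition twisted_morphism (r : nat) (G H : naGroupType)
    (tG : twisted_group r G) (tH : twisted_group r H) (f : G -> H) : Prop :=
  [/\ continuous_for (tw_top tG) (tw_top tH) f,
      forall g, f (tw_conj tG g) = tw_conj tH (f g)
    & exists (F : {additive tw_ring tG -> tw_ring tH})
             (F_ : forall j, {rmorphism tw_comp tG j -> tw_comp tH j}),
      [/\ {morph F : x y / x * y} /\ F 1 = 1,
          forall g, F (tw_unit tG g) = tw_unit tH (f g),
          forall j y, F (tw_in tG j y) = tw_in tH j (F_ j y)
        & forall j k y, F_ k (tw_iso tG j k y) = tw_iso tH j k (F_ j y)]].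

(** * Pre-sheaves of groups *)

Record opens (X : topologicalType) := Opens {
  opens_set :> set X;
  opens_open : open opens_set
}.

Definition opens_T (X : topologicalType) : opens X := Opens openT.
Definition opens_I (X : topologicalType) (U V : opens X) : opens X :=
  Opens (openI (opens_open U) (opens_open V)).

Lemma opens_Il (X : topologicalType) (U V : opens X) : opens_I U V `<=` U.
Proof. exact: subIsetl. Qed.

Lemma opens_Ir (X : topologicalType) (U V : opens X) : opens_I U V `<=` V.
Proof. exact: subIsetr. Qed.

(* [sections0] is the usual normalization A(set0) = {e}: the compatibility
   conditions in [gluing] are void on empty intersections. *)
Record presheaf (X : topologicalType) := Presheaf {
  sections :> opens X -> naGroupType;
  res : forall U V : opens X, V `<=` U -> sections U -> sections V;
  res_morphism : forall (U V : opens X) (h : V `<=` U), na_morphism (res h);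
  res_id : forall (U : opens X) (h : U `<=` U) s, res h s = s;
  res_comp : forall (U V W : opens X) (h : V `<=` U) (k : W `<=` V)
    (l : W `<=` U) s, res k (res h s) = res l s;
  sections0 : forall U : opens X, opens_set U = set0 ->
    forall s t : sections U, s = t
}.

Definition twisted_presheaf (r : nat) (X : topologicalType) (A : presheaf X)
    : Prop :=
  exists tA : forall U : opens X, twisted_group r (A U),
    forall (U V : opens X) (h : V `<=` U),
      twisted_morphism (tA U) (tA V) (res h).

Definition gluing (X : topologicalType) (A : presheaf X) : Prop :=
  forall (J : Type) (U_ : J -> opens X) (U : opens X) (s_ : forall j, A (U_ j)),
    \bigcup_j U_ j = U ->
    (forall j k,
       res (@opens_Il _ (U_ j) (U_ k)) (s_ j) =
       res (@opens_Ir _ (U_ j) (U_ k)) (s_ k)) ->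
    exists s : A U, forall j (h : U_ j `<=` U), res h s = s_ j.

(** * The sheaf generated by a pre-sheaf *)

Section GeneratedSheaf.
Variables (X : topologicalType) (A : presheaf X).

Section Stalk.
Variable x : X.

Record local_section := LocalSection {
  ls_dom : opens X;
  ls_sec : A ls_dom;
  ls_mem : opens_set ls_dom x
}.

HB.instance Definition _ := gen_eqMixin local_section.
HB.instance Definition _ := gen_choiceMixin local_section.

Definition same_germ (s t : local_section) : Prop :=
  exists (W : opens X) (hs : W `<=` ls_dom s) (ht : W `<=` ls_dom t),
    opens_set W x /\ res hs (ls_sec s) = res ht (ls_sec t).

Definition same_germb (s t : local_section) : bool := `[< same_germ s t >].

Lemma same_germ_refl : reflexive same_germb.
Proof.
move=> s; apply/asboolP.
by exists (ls_dom s), (@subset_refl _ _), (@subset_refl _ _); split=> //; exact: ls_mem.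
Qed.

Lemma same_germ_sym : symmetric same_germb.
Proof.
move=> s t; apply/asboolP/asboolP => -[W [hs [ht [Wx e]]]];
by exists W, ht, hs; split.
Qed.

Lemma same_germ_trans : transitive same_germb.
Proof.
move=> t s u /asboolP[W [hs [ht [Wx e]]]] /asboolP[W' [ht' [hu [Wx' e']]]].
have k : opens_I W W' `<=` W by exact: subIsetl.
have k' : opens_I W W' `<=` W' by exact: subIsetr.
apply/asboolP; exists (opens_I W W').
exists (subset_trans k hs), (subset_trans k' hu); split; first by split.
rewrite -(res_comp hs k) -(res_comp hu k') e -e'.
by rewrite (res_comp _ _ (subset_trans k ht)) (res_comp _ _ (subset_trans k ht)).
Qed.

Canonical same_germ_equiv :=
  EquivRel same_germb same_germ_refl same_germ_sym same_germ_trans.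

Definition stalk := {eq_quot same_germ_equiv}%qT.
HB.instance Definition _ := Choice.on stalk.

Definition germ (U : opens X) (Ux : opens_set U x) (s : A U) : stalk :=
  (\pi_stalk (LocalSection s Ux))%qT.

Lemma germP (U V : opens X) (Ux : opens_set U x) (Vx : opens_set V x)
    (s : A U) (t : A V) :
  germ Ux s = germ Vx t <->
  exists (W : opens X) (hU : W `<=` U) (hV : W `<=` V),
    opens_set W x /\ res hU s = res hV t.
Proof.
split=> [/eqmodP/asboolP //|h].
by apply/eqmodP/asboolP.
Qed.

Lemma germ_res (U V : opens X) (h : V `<=` U) (Vx : opens_set V x) (s : A U) :
  germ Vx (res h s) = germ (h x Vx) s.
Proof.
apply/germP; exists V, (@subset_refl _ _), h; split=> //.
exact: res_id.
Qed.

Lemma stalkP (c : stalk) :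
  exists (U : opens X) (Ux : opens_set U x) (s : A U), c = germ Ux s.
Proof.
case: (repr c) (reprK c) => U s Ux e.
by exists U, Ux, s; rewrite /germ -e.
Qed.

Lemma stalkP2 (c d : stalk) :
  exists (U : opens X) (Ux : opens_set U x) (s t : A U),
    c = germ Ux s /\ d = germ Ux t.
Proof.
have [U [Ux [s ->]]] := stalkP c; have [V [Vx [t ->]]] := stalkP d.
have h : opens_I U V `<=` U by exact: subIsetl.
have k : opens_I U V `<=` V by exact: subIsetr.
have Wx : opens_set (opens_I U V) x by split.
exists (opens_I U V), Wx, (res h s), (res k t); rewrite !germ_res.
by split; congr germ; exact: Prop_irrelevance.
Qed.

Definition stalk_one : stalk := germ (U := opens_T X) I 1.

Definition stalk_mul (c d : stalk) : stalk :=
  let s := repr c in let t := repr d in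
  germ (U := opens_I (ls_dom s) (ls_dom t)) (conj (ls_mem s) (ls_mem t))
    (res (@opens_Il _ _ _) (ls_sec s) * res (@opens_Ir _ _ _) (ls_sec t)).

Definition stalk_inv (c : stalk) : stalk :=
  let s := repr c in germ (ls_mem s) (ls_sec s)^-1.

Lemma germ_repr (U : opens X) (Ux : opens_set U x) (s : A U) :
  same_germ (repr (germ Ux s)) (LocalSection s Ux).
Proof. by apply/asboolP/(eqmodP same_germ_equiv); rewrite reprK. Qed.

Lemma germM (U : opens X) (Ux : opens_set U x) (s t : A U) :
  germ Ux (s * t) = stalk_mul (germ Ux s) (germ Ux t).
Proof.
rewrite /stalk_mul; apply/germP.
have [W [h [k [Wx /= e]]]] := germ_repr Ux s.
have [W' [h' [k' [Wx' /= e']]]] := germ_repr Ux t.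
have l : opens_I W W' `<=` W by exact: subIsetl.
have l' : opens_I W W' `<=` W' by exact: subIsetr.
have hV : opens_I W W' `<=` opens_I (ls_dom (repr (germ Ux s)))
                                    (ls_dom (repr (germ Ux t))).
  by move=> y [/h ? /h' ?].
exists (opens_I W W'), (subset_trans l k), hV; split; first by split.
have [-> _ _] := res_morphism A (subset_trans l k).
have [-> _ _] := res_morphism A hV.
rewrite !(res_comp _ hV (subset_trans l h), res_comp _ hV (subset_trans l' h')).
rewrite -(res_comp h l) -(res_comp h' l') e e' !(res_comp _ _ (subset_trans l k)).
by [].
Qed.

Lemma germ1 (U : opens X) (Ux : opens_set U x) : germ Ux 1 = stalk_one.
Proof.
apply/germP; exists U, (@subset_refl _ _), (@subsetT _ _); split=> //.
by have [_ -> _] := res_morphism A (@subset_refl _ U);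
   have [_ -> _] := res_morphism A (V := U) (U := opens_T X) (@subsetT _ _).
Qed.

Lemma germV (U : opens X) (Ux : opens_set U x) (s : A U) :
  germ Ux s^-1 = stalk_inv (germ Ux s).
Proof.
rewrite /stalk_inv; apply/germP.
have [W [h [k [Wx /= e]]]] := germ_repr Ux s.
exists W, k, h; split=> //.
have [_ _ ->] := res_morphism A k; have [_ _ ->] := res_morphism A h.
by rewrite e.
Qed.

Lemma stalk_mul1g : left_id stalk_one stalk_mul.
Proof.
move=> c; have [U [Ux [s ->]]] := stalkP c.
by rewrite -(germ1 Ux) -germM mul1g.
Qed.

Lemma stalk_mulg1 : right_id stalk_one stalk_mul.
Proof.
move=> c; have [U [Ux [s ->]]] := stalkP c.
by rewrite -(germ1 Ux) -germM mulg1.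
Qed.

Lemma stalk_mulVg : forall c, stalk_mul (stalk_inv c) c = stalk_one.
Proof.
move=> c; have [U [Ux [s ->]]] := stalkP c.
by rewrite -germV -germM mulNAVg germ1.
Qed.

Lemma stalk_mulgV : forall c, stalk_mul c (stalk_inv c) = stalk_one.
Proof.
move=> c; have [U [Ux [s ->]]] := stalkP c.
by rewrite -germV -germM mulNAgV germ1.
Qed.

HB.instance Definition _ := hasMul.Build stalk stalk_mul.
HB.instance Definition _ := hasOne.Build stalk stalk_one.
HB.instance Definition _ :=
  BaseUMagma_isUMagma.Build stalk stalk_mul1g stalk_mulg1.
HB.instance Definition _ := 
  UMagma_isNAGroup.Build stalk stalk_mulVg stalk_mulgV.

End Stalk.

Section Sections.
Variable U : opens X.

(* Continuity of a section of the projection of the space of germs onto X. *)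
Definition locally_germ (s : forall x, opens_set U x -> stalk x) : Prop :=
  forall x, opens_set U x -> exists (V : opens X) (t : A V),
    opens_set V x /\
    forall y (Uy : opens_set U y) (Vy : opens_set V y), s y Uy = germ Vy t.

Record sheaf_section := SheafSection {
  sheaf_val :> forall x, opens_set U x -> stalk x;
  sheaf_valP : locally_germ sheaf_val
}.

HB.instance Definition _ := gen_eqMixin sheaf_section.
HB.instance Definition _ := gen_choiceMixin sheaf_section.

Lemma sheaf_sectionP (s t : sheaf_section) :
  (forall x (Ux : opens_set U x), s x Ux = t x Ux) -> s = t.
Proof.
case: s t => [s sP] [t tP] /= e.
have st : s = t by apply: functional_extensionality_dep => x; exact: funext.
by case: _ / st in tP e *; congr SheafSection; exact: Prop_irrelevance.
Qed.

Lemma locally_germ1 : locally_germ (fun x _ => 1).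
Proof.
move=> x Ux; exists (opens_T X), 1; split=> // y _ Vy.
by rewrite germ1.
Qed.

Lemma locally_germM (s t : sheaf_section) :
  locally_germ (fun x Ux => s x Ux * t x Ux).
Proof.
move=> x Ux.
have [V [a [Vx sa]]] := sheaf_valP s Ux.
have [W [b [Wx tb]]] := sheaf_valP t Ux.
have h : opens_I V W `<=` V by exact: subIsetl.
have k : opens_I V W `<=` W by exact: subIsetr.
exists (opens_I V W), (res h a * res k b); split; first by split.
by move=> y Uy VWy; rewrite germM !germ_res (sa y Uy (h y VWy)) (tb y Uy (k y VWy)).
Qed.

Lemma locally_germV (s : sheaf_section) :
  locally_germ (fun x Ux => (s x Ux)^-1).
Proof.
move=> x Ux; have [V [a [Vx sa]]] := sheaf_valP s Ux.
by exists V, a^-1; split=> // y Uy Vy; rewrite germV (sa y Uy Vy).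
Qed.

HB.instance Definition _ := hasMul.Build sheaf_section
  (fun s t => SheafSection (locally_germM s t)).
HB.instance Definition _ := hasOne.Build sheaf_section
  (SheafSection locally_germ1).

Lemma sheaf_mul1g : forall s : sheaf_section, 1 * s = s.
Proof. by move=> s; apply: sheaf_sectionP => x Ux; exact: mul1g. Qed.

Lemma sheaf_mulg1 : forall s : sheaf_section, s * 1 = s.
Proof. by move=> s; apply: sheaf_sectionP => x Ux; exact: mulg1. Qed.

HB.instance Definition _ :=
  BaseUMagma_isUMagma.Build sheaf_section sheaf_mul1g sheaf_mulg1.
Definition sheaf_inv (s : sheaf_section) : sheaf_section :=
  SheafSection (locally_germV s).

Lemma sheaf_mulVg : forall s : sheaf_section, sheaf_inv s * s = 1.
Proof. by move=> s; apply: sheaf_sectionP => x Ux; exact: mulNAVg. Qed.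

Lemma sheaf_mulgV : forall s : sheaf_section, s * sheaf_inv s = 1.
Proof. by move=> s; apply: sheaf_sectionP => x Ux; exact: mulNAgV. Qed.

HB.instance Definition _ :=
  UMagma_isNAGroup.Build sheaf_section sheaf_mulVg sheaf_mulgV.

End Sections.

Lemma sheaf_res_subproof (U V : opens X) (h : V `<=` U) (s : sheaf_section U) :
  locally_germ (fun x (Vx : opens_set V x) => s x (h x Vx)).
Proof.
move=> x Vx; have [W [t [Wx st]]] := sheaf_valP s (h x Vx).
by exists W, t; split=> // y Vy Wy; exact: st.
Qed.

Definition sheaf_res (U V : opens X) (h : V `<=` U) (s : sheaf_section U) :
  sheaf_section V := SheafSection (sheaf_res_subproof h s).

Lemma sheaf_res_morphism (U V : opens X) (h : V `<=` U) :
  na_morphism (sheaf_res h).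
Proof.
by split=> [s t||s]; apply: sheaf_sectionP.
Qed.

Lemma sheaf_res_id (U : opens X) (h : U `<=` U) s : sheaf_res h s = s.
Proof.
apply: sheaf_sectionP => x Ux /=; congr (sheaf_val s _).
exact: Prop_irrelevance.
Qed.

Lemma sheaf_res_comp (U V W : opens X) (h : V `<=` U) (k : W `<=` V)
  (l : W `<=` U) s : sheaf_res k (sheaf_res h s) = sheaf_res l s.
Proof.
apply: sheaf_sectionP => x Ux /=; congr (sheaf_val s _).
exact: Prop_irrelevance.
Qed.

Lemma sheaf_sections0 (U : opens X) : opens_set U = set0 ->
  forall s t : sheaf_section U, s = t.
Proof.
move=> U0 s t; apply: sheaf_sectionP => x Ux.
by exfalso; rewrite U0 in Ux.
Qed.

Definition generated_sheaf : presheaf X := Presheaf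
  sheaf_res_morphism sheaf_res_id sheaf_res_comp sheaf_sections0.

Lemma theta_subproof (U : opens X) (s : A U) :
  locally_germ (fun x (Ux : opens_set U x) => germ Ux s).
Proof.
move=> x Ux; exists U, s; split=> // y Uy Uy'.
by congr germ; exact: Prop_irrelevance.
Qed.

Definition theta (U : opens X) (s : A U) : generated_sheaf U :=
  SheafSection (theta_subproof s).

End GeneratedSheaf.

Arguments theta {X A U} s.

(** * Supports *)

Definition sheaf_support (X : topologicalType) (A : presheaf X)
    (s : generated_sheaf A (opens_T X)) : set X :=
  [set x | s x I <> 1].

Definition presheaf_support (X : topologicalType) (A : presheaf X)
    (s : A (opens_T X)) : set X :=
  sheaf_support (theta s).

Definition Gamma_phi (X : topologicalType) (A : presheaf X) (phi : set (set X)) :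
  set (generated_sheaf A (opens_T X)) := [set s | phi (sheaf_support s)].

Definition A_phi (X : topologicalType) (A : presheaf X)
    (phi : set (set X)) : set (A (opens_T X)) :=
  [set s | phi (presheaf_support s)].

Definition A_0 (X : topologicalType) (A : presheaf X) :
  set (A (opens_T X)) := [set s | presheaf_support s = set0].

Arguments Gamma_phi {X} A phi.
Arguments A_phi {X} A phi.
Arguments A_0 {X} A.

(* Hausdorff spaces are meant: without separation, local lifts of a section
   cannot be glued in general. *)
Definition paracompact (T : topologicalType) : Prop :=
  hausdorff_space T /\
  forall C : set (set T), C `<=` open -> \bigcup_(U in C) U = setT ->
    exists D : set (set T),
      [/\ D `<=` open, \bigcup_(V in D) V = setT,
          forall V, D V -> exists2 U, C U & V `<=` U
        & forall x : T, exists2 W, nbhs x W &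
            finite_set [set V | D V /\ V `&` W !=set0]].

(* The empty union is included in the second condition. *)
Definition family_of_supports (X : topologicalType) (phi : set (set X)) : Prop :=
  [/\ phi `<=` closed,
      forall F K, phi F -> closed K -> K `<=` F -> phi K
    & forall D : set (set X), finite_set D -> D `<=` phi ->
        phi (\bigcup_(F in D) F)].

Definition paracompactifying (X : topologicalType) (phi : set (set X)) : Prop :=
  [/\ family_of_supports phi,
      forall F, phi F -> paracompact (set_type F)
    & forall F, phi F -> exists N, [/\ phi N, closed N & set_nbhs F N]].

(** * Exact sequences *)

(* Exactness of the sequence e -> A -> B -> C -> e of subgroups A, B of G and C
   of H, whose first map is the inclusion, hence has trivial kernel, and whose
   second map is induced by f. *)
Record exact_sequence (G H : naGroupType) (A B : set G) (C : set H)
    (f : G -> H) : Prop := ExactSequence {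
  exact_subgroupA : na_subgroup A;
  exact_subgroupB : na_subgroup B;
  exact_subgroupC : na_subgroup C;
  exact_incl : A `<=` B;
  exact_morphism : na_morphism f;
  exact_middle : A = [set s | B s /\ f s = 1];
  exact_right : f @` B = C
}.

(* Main.v *)
(* Only surjectivity of theta needs an argument. Every point has a neighborhood
   on which s lifts to the pre-sheaf, but two local lifts need only have equal
   germs, so they agree on a smaller neighborhood of each point and not on the
   overlap of their domains. Take a locally finite closed cover D of X each member
   of which lies in an open set carrying a lift. Every x has a neighborhood W x
   that meets no member of D not containing x and on which the finitely many
   lifts given by the members containing x coincide; if z lies in W x and W y,
   then a member containing z contains x and y, so the lifts on W x and W y agree
   on the overlap and can be glued. *)

Require Import Defs.
From mathcomp Require Import all_boot all_classical topology.

Set Implicit Arguments.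
Unset Strict Implicit.
Unset Printing Implicit Defensive.

Local Open Scope classical_set_scope.
Local Open Scope group_scope.

(** * Locally finite families in paracompact spaces *)

(** The finiteness clause of [paracompact], isolated so that it also applies to families of closed
    sets. *)
Definition locally_finite (T : topologicalType) (D : set (set T)) : Prop :=
  forall x : T, exists2 W, nbhs x W &
    finite_set [set V | D V /\ V `&` W !=set0].

Lemma near_finite_set (T : topologicalType) (I : choiceType) (E : set I)
    (P : I -> set T) (x : T) :
  finite_set E -> (forall i, E i -> nbhs x (P i)) ->
  nbhs x [set y | forall i, E i -> P i y].
Proof.
move=> /finite_fsetP[F ->] xP.
exact: (@filter_bigI _ _ F P (nbhs x) _ xP).
Qed.

(** Some neighborhood of [x] meets only finitely many members, and each closed member missing [x]
    can be avoided by an open neighborhood. *)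
Lemma near_locally_finite (T : topologicalType) (D : set (set T)) (x : T) :
  locally_finite D -> D `<=` closed ->
  nbhs x [set y | forall C, D C -> C y -> C x].
Proof.
move=> Dfin Dcl; have [W Wx fin] := Dfin x.
have near_fin :
    nbhs x [set y | forall C, [set V | D V /\ V `&` W !=set0] C -> C y -> C x].
  apply: (near_finite_set (P := fun C : set T => [set y | C y -> C x]) fin).
  move=> C [DC _]; have [Cx|nCx] := pselect (C x).
    by apply: filterS (@filterT _ (nbhs x) _) => y _ _.
  have oC : open (~` C) by rewrite openC; exact: Dcl.
  by apply: filterS (open_nbhs_nbhs (conj oC nCx)) => y nCy Cy.
apply: filterS (filterI Wx near_fin) => y [Wy h] C DC Cy.
by apply: h => //; split=> //; exists y.
Qed.

(** An open set that meets the closure of [V] meets [V], so the interior of [W] meets no new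
    closures. *)
Lemma locally_finite_closure (T : topologicalType) (D : set (set T)) :
  locally_finite D -> locally_finite (closure @` D).
Proof.
move=> Dfin x; have [W Wx fin] := Dfin x.
exists W°; first by apply: nbhs_interior.
apply: sub_finite_set (finite_image closure fin) => _ [[V DV <-] [y [cVy Wy]]].
exists V => //; split=> //.
by have [z [Vz /interior_subset Wz]] := cVy _ (nbhs_interior Wy); exists z.
Qed.

(* To separate x from the complement of O, cover the latter by open sets whose
   closures miss x: local finiteness keeps x off the closure of their union. *)
Lemma paracompact_regular (T : topologicalType) :
  paracompact T -> regular_space T.
Proof.
move=> [hT pT] x O Ox.
have [||D [Dop Dcov Dsub Dfin]] :=
  pT [set P | open P /\ (P `<=` O \/ ~ closure P x)].
- by move=> P [].
- rewrite -subTset => y _; have [Oy|nOy] := pselect (O° y).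
    exists O° => //; split; first exact: open_interior.
    by left; exact: interior_subset.
  (* [hausdorff_space] says that [nbhs x] clusters only at [x]; failing to cluster at [y] yields
     disjoint neighborhoods of [x] and [y]. *)
  have : ~ cluster (nbhs x) y.
    by move=> /hT xy; apply: nOy; rewrite -xy; exact: Ox.
  move=> /existsNP[V] /existsNP[W] /not_implyP[Vx] /not_implyP[Wy VW].
  exists W°; last exact: Wy.
  split; [exact: open_interior | right => cWx; apply: VW].
  by have [z [/interior_subset Wz Vz]] := cWx _ Vx; exists z.
exists [set y | forall C, (closure @` D) C -> C y -> C x].
  apply: near_locally_finite; first exact: locally_finite_closure.
  by move=> _ [V _ <-]; exact: closed_closure.
move=> y cy.
have [V DV Vy] : (\bigcup_(V in D) V) y by rewrite Dcov.
have [z [zx Vz]] := cy V (open_nbhs_nbhs (conj (Dop _ DV) Vy)).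
(* This rules out the second alternative for the set that [V] refines, so [V] lies in [O]. *)
have cVx : closure V x.
  by apply: (zx (closure V)); [exists V | exact: subset_closure].
have [P [_ [PO|nPx]] VP] := Dsub V DV; first exact/PO/VP.
by case: nPx; exact: closureS VP _ cVx.
Qed.

(** By regularity the open sets whose closure lies in a member of [C] still cover; the closures of a
    locally finite refinement of that cover serve as [D]. *)
Lemma paracompact_closed_refinement (T : topologicalType) (C : set (set T)) :
  paracompact T -> C `<=` open -> \bigcup_(U in C) U = setT ->
  exists D : set (set T),
    [/\ D `<=` closed, \bigcup_(K in D) K = setT,
        forall K, D K -> exists2 U, C U & K `<=` U & locally_finite D].
Proof.
move=> pT Cop Ccov; have rT := paracompact_regular pT; have [_ cT] := pT.
have [||D [Dop Dcov Dsub Dfin]] :=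
  cT [set P | open P /\ exists2 U, C U & closure P `<=` U].
- by move=> P [].
- rewrite -subTset => y _.
  have [U CU Uy] : (\bigcup_(U in C) U) y by rewrite Ccov.
  have [W Wy cWU] := rT y U (open_nbhs_nbhs (conj (Cop _ CU) Uy)).
  exists W°; last exact: Wy.
  split; first exact: open_interior.
  exists U => //; apply: subset_trans cWU.
  by apply: closureS; exact: interior_subset.
exists (closure @` D); split.
- by move=> _ [V _ <-]; exact: closed_closure.
- rewrite -subTset -Dcov => y [V DV Vy].
  by exists (closure V); [exists V | exact: subset_closure].
- move=> _ [V DV <-]; have [P [_ [U CU PU]] VP] := Dsub V DV.
  by exists U => //; exact: subset_trans (closureS VP) PU.
- exact: locally_finite_closure.
Qed.

Lemma locally_finite_setU1 (T : topologicalType) (D : set (set T)) (C : set T) :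
  locally_finite D -> locally_finite (C |` D).
Proof.
move=> Dfin x; have [W Wx fin] := Dfin x; exists W => //.
apply: (@sub_finite_set _ _ (C |` [set V | D V /\ V `&` W !=set0])).
  by move=> V [[->|DV] VW]; [left | right].
by rewrite finite_setU; split=> //; exact: finite_set1.
Qed.

(** * Transfer from a closed subspace to the whole space *)

Section ClosedSubspace.
Variables (X : topologicalType) (F : set X).
Hypothesis Fcl : closed F.

Lemma nbhs_set_type (z : set_type F) (W : set (set_type F)) :
  nbhs z W -> exists2 O, open_nbhs (set_val z) O & set_val @^-1` O `<=` W.
Proof. by move=> [_ [[O oO <-] Oz OW]]; exists O. Qed.

Lemma closed_set_val_image (K : set (set_type F)) :
  closed K -> closed (set_val @` K).
Proof.
move=> Kcl x cx.
have Fx : F x.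
  apply: Fcl; apply: closureS cx => _ [z _ <-]; exact: set_valP.
exists (exist _ x (mem_set Fx)) => //; apply: Kcl => W.
move=> /nbhs_set_type[O /= Ox OW].
have [_ [[z Kz <-] Oz]] := cx O (open_nbhs_nbhs Ox).
by exists z; split=> //; exact: OW.
Qed.

(** Points outside [F] cause no trouble: the complement of [F] is open and meets no image. *)
Lemma locally_finite_set_val_image (D : set (set (set_type F))) :
  locally_finite D -> locally_finite ((fun K => set_val @` K) @` D).
Proof.
move=> Dfin x; have [Fx|nFx] := pselect (F x); last first.
  exists (~` F); first by apply: open_nbhs_nbhs; split=> //; exact: closed_openC.
  apply: sub_finite_set (finite_set0 (set X)) => _ [[K _ <-] [_ [[z _ <-] nFz]]].
  by case: nFz; exact: set_valP.
have [W /nbhs_set_type[O /= Ox OW] fin] := Dfin (exist _ x (mem_set Fx)).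
exists O; first exact: open_nbhs_nbhs.
apply: sub_finite_set (finite_image (fun K => set_val @` K) fin).
move=> _ [[K DK <-] [_ [[z Kz <-] Oz]]]; exists K => //.
by split=> //; exists z; split=> //; exact: OW.
Qed.

End ClosedSubspace.

(** * Local lifts of a section and their gluing *)

Section Lifting.
Variables (X : topologicalType) (A : presheaf X).
Variable s : generated_sheaf A (opens_T X).

Definition lifts (U : opens X) (t : A U) : Prop :=
  forall x (Ux : opens_set U x), s x I = germ Ux t.

Lemma lifts_res (U V : opens X) (h : V `<=` U) (t : A U) :
  lifts t -> lifts (res h t).
Proof. by move=> st x Vx; rewrite germ_res. Qed.

Lemma exists_lift (x : X) :
  exists (U : opens X) (t : A U), opens_set U x /\ lifts t.
Proof.
have [U [t [Ux st]]] := sheaf_valP s (x := x) I.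
by exists U, t; split=> // y Uy; exact: st.
Qed.

Lemma lifts_agree_near (U V : opens X) (t : A U) (u : A V) (x : X) :
  lifts t -> lifts u -> opens_set U x -> opens_set V x ->
  exists W : opens X, opens_set W x /\
    exists (h : W `<=` U) (k : W `<=` V), res h t = res k u.
Proof.
move=> st su Ux Vx; have /germP[W [h [k [Wx e]]]] : germ Ux t = germ Vx u.
  by rewrite -st -su.
by exists W; split=> //; exists h, k.
Qed.

(** The witness is the lift of one member [C0] containing [x], restricted until it agrees with the
    lifts of all members containing [x]. Any member that meets the new domain contains [x], so the
    last clause can range over all points [y]. *)
Lemma common_lift (D : set (set X)) (L : set X -> {U : opens X & A U}) (x : X) :
  locally_finite D -> D `<=` closed -> \bigcup_(C in D) C = setT ->
  (forall C, D C -> C `<=` opens_set (projT1 (L C)) /\ lifts (projT2 (L C))) ->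
  exists w : {W : opens X & A W},
    [/\ opens_set (projT1 w) x,
        lifts (projT2 w)
      & forall y C, opens_set (projT1 w) y -> D C -> C y ->
          exists h : projT1 w `<=` projT1 (L C),
            res h (projT2 (L C)) = projT2 w].
Proof.
move=> Dfin Dcl Dcov DL.
have [C0 DC0 C0x] : (\bigcup_(C in D) C) x by rewrite Dcov.
pose E := [set C | D C /\ C x].
have Efin : finite_set E.
  have [W Wx] := Dfin x; apply: sub_finite_set => C [DC Cx].
  by split=> //; exists x; split=> //; exact: nbhs_singleton.
(* [choice] needs a total relation, so outside [E] the whole space is a dummy value. *)
have /choice[N NP] : forall C, exists W : opens X, E C ->
    opens_set W x /\
    exists (h : W `<=` projT1 (L C0)) (k : W `<=` projT1 (L C)),
      res h (projT2 (L C0)) = res k (projT2 (L C)).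
  move=> C; have [[DC Cx]|nEC] := pselect (E C); last by exists (opens_T X).
  have [C0L lC0] := DL _ DC0; have [CL lC] := DL _ DC.
  by have [W ?] := lifts_agree_near lC0 lC (C0L _ C0x) (CL _ Cx); exists W.
have near_N : nbhs x [set y | forall C, E C -> opens_set (N C) y].
  apply: (near_finite_set (P := fun C => opens_set (N C)) Efin) => C /NP[Nx _].
  exact: open_nbhs_nbhs (conj (opens_open _) Nx).
have := filterI (near_locally_finite x Dfin Dcl) near_N.
set M := (M in nbhs x M) => Mx.
pose W := Opens (open_interior M).
have WN C : E C -> W `<=` N C by move=> EC y /interior_subset[_]; exact.
have [_ [h0 _]] := NP C0 (conj DC0 C0x).
have WL := subset_trans (WN C0 (conj DC0 C0x)) h0.
exists (existT _ W (res WL (projT2 (L C0)))).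
split=> /=; first exact: Mx.
  by apply: lifts_res; have [] := DL _ DC0.
move=> y C Wy DC Cy.
have EC : E C by split=> //; have [My _] := interior_subset Wy; exact: My Cy.
have [_ [h [k e]]] := NP C EC.
exists (subset_trans (WN C EC) k).
by rewrite -(res_comp k (WN C EC)) -e (res_comp _ _ (subset_trans (WN C EC) h));
  congr res; exact: Prop_irrelevance.
Qed.

Lemma glue_lifts (D : set (set X)) :
  gluing A -> locally_finite D -> D `<=` closed ->
  \bigcup_(C in D) C = setT ->
  (forall C, D C ->
     exists (U : opens X) (t : A U), C `<=` opens_set U /\ lifts t) ->
  exists a : A (opens_T X), theta a = s.
Proof.
move=> hglue Dfin Dcl Dcov DL.
have /choice[L LP] : forall C, exists p : {U : opens X & A U},
    D C -> C `<=` opens_set (projT1 p) /\ lifts (projT2 p).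
  move=> C; have [/DL[U [t ?]]|nDC] := pselect (D C).
    by exists (existT _ U t).
  by exists (existT _ (opens_T X) (1 : A (opens_T X))).
have /choice[w wP] := fun x => common_lift x Dfin Dcl Dcov LP.
have [|x y|a aw] := hglue X (fun x => projT1 (w x)) (opens_T X)
    (fun x => projT2 (w x)).
- by rewrite -subTset => x _; exists x => //; have [] := wP x.
(* A common point [z] exists only on a nonempty overlap; over the empty set all sections coincide by
   [sections0]. *)
- have [[z [wxz wyz]]|W0] :=
    pselect (opens_I (projT1 (w x)) (projT1 (w y)) !=set0); last first.
    by apply: sections0; apply/eqP/negPn/negP => /set0P.
  have [C DC Cz] : (\bigcup_(C in D) C) z by rewrite Dcov.
  have [_ _ /(_ z C wxz DC Cz)[h <-]] := wP x.
  have [_ _ /(_ z C wyz DC Cz)[k <-]] := wP y.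
  rewrite (res_comp _ _ (subset_trans (@opens_Il _ _ _) h)).
  by rewrite (res_comp _ _ (subset_trans (@opens_Il _ _ _) h)).
exists a; apply: sheaf_sectionP => x Tx /=.
have [wx lw _] := wP x.
rewrite (Prop_irrelevance Tx I) (lw x wx) -(aw x (@subsetT _ _)) germ_res.
by congr germ; exact: Prop_irrelevance.
Qed.

End Lifting.

(** * Subgroups given by supports, and surjectivity of [theta] *)

Lemma na_inv1 (G : naGroupType) : na_inv (1 : G) = 1.
Proof. by rewrite -[LHS]mulg1 mulNAVg. Qed.

Lemma na_subgroup_preimage (G H : naGroupType) (f : G -> H) (B : set H) :
  na_morphism f -> na_subgroup B -> na_subgroup (f @^-1` B).
Proof.
move=> [fM f1 fV] [B1 BM BV]; split=> [|x y Bx By|x Bx]; rewrite /preimage/=.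
- by rewrite f1.
- by rewrite fM; exact: BM.
- by rewrite fV; exact: BV.
Qed.

Section Supports.
Variables (X : topologicalType) (A : presheaf X).
Implicit Types s t : generated_sheaf A (opens_T X).

Lemma theta_morphism (U : opens X) : na_morphism (@theta X A U).
Proof.
split=> [s t||s]; apply: sheaf_sectionP => x Ux /=.
- exact: germM.
- exact: germ1.
- exact: germV.
Qed.

(** Equality of germs at a point spreads to a neighborhood, so the set where [s] equals [1] is
    open. *)
Lemma closed_sheaf_support s : closed (sheaf_support s).
Proof.
rewrite -openC openE => x /contrapT sx1.
have [U [t [Ux st]]] := exists_lift s x.
have /germP[W [h [k [Wx e]]]] : germ Ux t = germ (U := opens_T X) I 1.
  by rewrite -st.
apply: filterS (open_nbhs_nbhs (conj (opens_open W) Wx)) => y Wy.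
by apply; rewrite (st y (h y Wy)) -germ_res e germ_res germ1.
Qed.

Lemma sheaf_support_eq0 s : sheaf_support s = set0 <-> s = 1.
Proof.
split=> [s0|->]; last by rewrite -subset0 => x; apply.
apply: sheaf_sectionP => x Tx; rewrite (Prop_irrelevance Tx I).
by apply: contrapT => sx; have : sheaf_support s x by []; rewrite s0.
Qed.

Lemma Gamma_phi_subgroup (phi : set (set X)) :
  family_of_supports phi -> na_subgroup (Gamma_phi A phi).
Proof.
move=> [_ phiS phiU]; split=> [|s t ps pt|s ps]; rewrite /Gamma_phi/=.
- rewrite (_ : sheaf_support _ = \bigcup_(F in set0) F); last first.
    by rewrite bigcup_set0; exact/sheaf_support_eq0.
  exact: phiU.
- apply: (phiS (sheaf_support s `|` sheaf_support t)).
  + rewrite -[X in X `|` _](bigcup_set1 id) -[X in _ `|` X](bigcup_set1 id).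
    rewrite -bigcup_setU; apply: phiU; first exact: finite_set2.
    by move=> _ [->|->].
  + exact: closed_sheaf_support.
  + move=> x stx; apply: contrapT => /not_orP[/contrapT sx /contrapT tx].
    by apply: stx; rewrite /= sx tx mulg1.
- apply: phiS ps _ _; first exact: closed_sheaf_support.
  by move=> x svx sx; apply: svx; rewrite /= sx na_inv1.
Qed.

(** For this family [A_phi] is [A_0], which makes [A_0] a subgroup by the general case. *)
Lemma family_of_supports_empty : family_of_supports [set set0 : set X].
Proof.
split=> [_ ->|_ K -> _|D _ D0]; first exact: closed0.
- by rewrite subset0.
- by rewrite /= bigcup0 // => F /D0.
Qed.

Lemma A_phi_subgroup (phi : set (set X)) :
  family_of_supports phi -> na_subgroup (A_phi A phi).
Proof.
move=> /Gamma_phi_subgroup; exact: na_subgroup_preimage (theta_morphism _).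
Qed.

(* Near the support s is lifted on a locally finite closed refinement of the
   paracompact neighborhood N; the complement of the interior of N is one more
   closed set, on whose neighborhood ~` |s| the section s is lifted by 1. *)
Lemma theta_lifting (phi : set (set X)) s :
  gluing A -> paracompactifying phi -> phi (sheaf_support s) ->
  exists a, theta a = s.
Proof.
move=> hglue [[phi_closed _ _] phi_para phi_nbhs] ps.
have [N [pN Ncl sN]] := phi_nbhs _ ps.
have [||D [Dcl Dcov Dsub Dfin]] := paracompact_closed_refinement
    (C := [set O : set (set_type N) | exists (U : opens X) (t : A U),
             O = set_val @^-1` opens_set U /\ lifts s t]) (phi_para _ pN).
- by move=> _ [U [t [-> _]]]; exists U => //; exact: opens_open.
- rewrite -subTset => x _; have [U [t [Ux st]]] := exists_lift s (set_val x).
  by exists (set_val @^-1` opens_set U) => //; exists U, t.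
apply: (@glue_lifts _ _ _ (~` N° |` (fun K => set_val @` K) @` D)) => //.
- exact/locally_finite_setU1/locally_finite_set_val_image.
- move=> _ [->|[K DK <-]]; first by rewrite closedC; exact: open_interior.
  by apply: closed_set_val_image => //; exact: Dcl.
- rewrite -subTset => x _; have [/interior_subset Nx|nNx] := pselect (N° x).
    pose z : set_type N := exist _ x (mem_set Nx).
    have [K DK Kz] : (\bigcup_(K in D) K) z by rewrite Dcov.
    by exists (set_val @` K); [right; exists K | exists z].
  by exists (~` N°) => //; left.
- move=> _ [->|[K DK <-]]; last first.
    have [_ [U [t [-> st]]] KU] := Dsub K DK.
    by exists U, t; split=> // _ [y Ky <-]; exact: KU.
  exists (Opens (closed_openC (@closed_sheaf_support s))), 1; split.
    by move=> x nNx sx; apply: nNx; exact: sN.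
  by move=> x Ux; rewrite germ1; exact: contrapT.
Qed.
End Supports.

Theorem theorem36 (X : topologicalType) (A : presheaf X) (r : nat)
    (hr : (1 <= r <= 3)%N)
    (hglue : gluing A)
    (htwA : twisted_presheaf r A)
    (htwS : twisted_presheaf r (generated_sheaf A))
    (phi : set (set X)) (hphi : paracompactifying phi) :
  exact_sequence (A_0 A) (A_phi A phi) (Gamma_phi A phi)
    (@theta X A (opens_T X)).
Proof.
have [hfam _ _] := hphi; have [_ phiS phiU] := hfam.
have A0_phi : A_0 A `<=` A_phi A phi.
  move=> a; rewrite /A_0 /A_phi /= => ->.
  by have := phiU set0; rewrite bigcup_set0; apply=> //; exact: finite_set0.
split=> //.
- exact: A_phi_subgroup (family_of_supports_empty X).
- exact: A_phi_subgroup.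
- exact: Gamma_phi_subgroup.
- exact: theta_morphism.
- apply/seteqP; split=> a /=.
    by move=> a0; split; [exact: A0_phi | exact/sheaf_support_eq0].
  by move=> [_ /sheaf_support_eq0].
(* A preimage of [s] has the support of [s] by definition, hence lies in [A_phi]. *)
- apply/seteqP; split=> [_ [a pa <-] //|s ps].
  have [a e] := theta_lifting hglue hphi ps; exists a => //.
  by rewrite /A_phi /= /presheaf_support e.
Qed.
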